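(* Let $G$ be a finite abelian group with $\operatorname{diam}^+(G)\ge4$. (i) If $3$ divides $|G|$, then $t_4(G)=\frac13|G|$; if every divisor of $|G|$ is congruent to $1$ modulo $3$, then $t_4(G)=\frac13(|G|-1)$. (ii) If $G$ is not of exponent $2$, then $$s_4(G)=\begin{cases}\frac13(|G|+\eta(G)) & \text{if } \eta(G)\neq0,\\ \frac13|G| & \text{if } \eta(G)=0 \text{ and } 3\mid |G|,\\ \frac13(|G|-1) & \text{if } \eta(G)=0 \text{ and } 3\nmid|G|.\end{cases}$$
   Context: Groups are written additively. For $A\subseteq G$ let $A_0:=A\cup\{0\}$ and $\langle A\rangle^+_\rho:=\rho A_0=\{a_1+\dots+a_\rho:a_i\in A_0\}$. $\operatorname{diam}^+_A(G):=\min\{\rho\in\mathbb{N}_0:\langle A\rangle^+_\rho=G\}$ ($\min\varnothing=\infty$); $\operatorname{diam}^+(G):=\max\{\operatorname{diam}^+_A(G):\langle A\rangle=G\}$. The period of $S\subseteq G$ is $\pi(S):=\{g\in G:S+g=S\}$; $S$ is aperiodic if $\pi(S)=\{0\}$. A subset $A\subseteq G$ is $\rho$-maximal if it is maximal under inclusion subject to $\operatorname{diam}^+_A(G)\ge\rho$, i.e. subject to $\langle A\rangle^+_{\rho-1}\neq G$. With the convention $\max\varnothing=0$: $s_\rho(G):=\max\{|A|: A\subseteq G,\ \rho\le\operatorname{diam}^+_A(G)<\infty\}$ and $t_\rho(G):=\max\{|A|: A \text{ is an aperiodic } \rho\text{-maximal generating set for } G\}$. Finally $\eta(G):=\max\{|H|: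 H\le G,\ \exp(G/H)\neq 2,\ |G/H|\equiv 2 \pmod 3\}\in\mathbb{N}_0$ (with $\max\varnothing=0$). *)

(* Defs.v *)
(* A finite abelian group is modelled as G : {group gT}
   with abelian G (written multiplicatively: 0 ~ 1, + ~ *, sumsets ~ set products). *)
From HB Require Import structures.
From mathcomp Require Import all_boot all_order all_fingroup all_solvable.
From Stdlib Require Import ClassicalEpsilon.
Set Implicit Arguments. Unset Strict Implicit. Unset Printing Implicit Defensive.
Import GroupScope.

Definition asbool (P : Prop) : bool :=
  if excluded_middle_informative P then true else false.

Section Defs.
Variable gT : finGroupType.

Definition sumpow (A : {set gT}) (rho : nat) : {set gT} :=
  iter rho (fun S => S * (1 |: A)) 1.

Definition diam_ge (G : {set gT}) (A : {set gT}) (rho : nat) : bool :=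
  [forall k : 'I_rho, sumpow A k != G].

Definition diam_finite (G : {set gT}) (A : {set gT}) : bool :=
  asbool (exists k : nat, sumpow A k = G).

(* diam^+(G) >= rho : the max over generating sets A of diam^+_A(G) is >= rho *)
Definition diam_plus_ge (G : {set gT}) (rho : nat) : Prop :=
  exists A : {set gT}, [/\ A \subset G, <<A>> = G & diam_ge G A rho].

Definition period (G S : {set gT}) : {set gT} := [set g in G | S :* g == S].

Definition aperiodic (G S : {set gT}) : bool := period G S == 1.

Definition rho_maximal (G : {set gT}) (rho : nat) (A : {set gT}) : bool :=
  maxset (fun B : {set gT} => (B \subset G) && diam_ge G B rho) A.

Definition s_rho (G : {set gT}) (rho : nat) : nat :=
  \max_(A : {set gT} | [&& A \subset G, diam_ge G A rho & diam_finite G A]) #|A|.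

Definition t_rho (G : {set gT}) (rho : nat) : nat :=
  \max_(A : {set gT} | [&& rho_maximal G rho A, <<A>> == G & aperiodic G A]) #|A|.

Definition eta_grp (G : {group gT}) : nat :=
  \max_(H : {group gT} | [&& H \subset G, exponent (G / H) != 2
                            & #|G / H| %% 3 == 2]) #|H|.

End Defs.

(* Main.v *)
(* Kneser's theorem, applied to [A * A * A <> G] with [H] the period of [A * A * A],
   gives [3 |A / H| <= |G / H| + 1]; all the upper bounds are read off from the residue
   of [|G / H|] modulo 3.  The critical case [3 |A / H| = |G / H| + 1] with [G / H] of
   exponent 2 has to be excluded for generating [A]: there a translate [B] of the image
   of [A] is sum-free and [B * B] is the complement of [B], so B carries a relation
   [b1 b2 b3 = b4 b5], and comparing [B] with the translates of the resulting copy of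
   the Clebsch graph, whose independence number is 5, yields [16 |B| <= 5 |G / H|].

   For the lower bounds, split off a cyclic factor [<[x]>] of maximal order [m] with
   complement [M], and take the union of the cosets [x^i M] for [i] below about [m / 3]
   and of a smaller set in the next coset when [m] is 1 modulo 3.  When 3 divides [|G|]
   and [L] has index 3, the set [{x}] together with [L] minus a point works.

   Kneser's theorem itself is proved by covering [A * B] with sets [C] satisfying
   [|C| + |period C| >= |A| + |B|] (Dyson transforms) and by showing that this lower
   bound passes to unions. *)
Require Import Defs.
From HB Require Import structures.
From mathcomp Require Import all_boot all_order all_fingroup all_solvable.
From mathcomp Require Import zify.
Set Implicit Arguments. Unset Strict Implicit. Unset Printing Implicit Defensive.

(** * Kneser's theorem *)

Lemma card_cosetpre_set (gT : finGroupType) (H : {group gT})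
    (C : {set coset_of H}) :
  #|(coset H @*^-1 C)%g| = #|C| * #|H|.
Proof.
rewrite -sum1_card (partition_big (coset H) (mem C)) /=; last first.
  by move=> x; case/morphpreP.
rewrite -sum_nat_const; apply: eq_bigr => c Cc.
have [y Ny def_c] := cosetP c; rewrite def_c in Cc *.
rewrite -(card_rcoset H y) -cosetpre_set1 // -sum1_card; apply: eq_bigl => x.
apply/idP/idP => [/andP[/morphpreP[Nx _] /eqP cx] | /morphpreP[Nx]].
  by apply/morphpreP; split=> //; apply/set1P.
by move/set1P=> cx; apply/andP; split; [apply/morphpreP; rewrite cx | apply/eqP].
Qed.

(** Take [a] of [M2] rows and [b] of [M1] columns in a grid with cells of size [h]. The columns have
    [b * (M2 - a)] cells off the rows, and symmetrically. Which alternative holds depends on whether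
    more rows or more columns are left out. *)
Lemma grid_missing_rows_count (h M1 M2 a b : nat) :
    0 < a < M2 -> 0 < b <= M1 ->
  M1 * h <= h * (b * (M2 - a)) + h \/ M2 * h <= h * (a * (M1 - b)) + h.
Proof.
move=> /andP[a0 aM] /andP[b0 bM].
have [u ->] : exists u, M2 = a + u.+1 by exists (M2 - a).-1; lia.
have [v ->] : exists v, M1 = b + v by exists (M1 - b); lia.
rewrite !addKn; case: (leqP v u.+1) => uv; [left | right].
  rewrite -mulnSr mulnC leq_mul2l; apply/orP; right; nia.
rewrite -mulnSr mulnC leq_mul2l; apply/orP; right; nia.
Qed.
(** [N], [m1], [m2], [h] stand for the orders of [H1 * H2], [H1], [H2], [H1 :&: H2]; cosets of [H1]
    are rows, cosets of [H2] columns. By [I * N = X * Y] the intersection has [a * b] cells. *)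
Lemma grid_periodic_count (N m1 m2 h a b M1 M2 X Y I : nat) :
   X = a * m1 -> Y = b * m2 -> N = M2 * m1 -> N = M1 * m2 -> m1 * m2 = N * h ->
   I * N = X * Y -> 0 < m1 -> 0 < m2 -> 0 < h -> 0 < X < N -> 0 < Y <= N ->
   m1 <= Y - I + h \/ m2 <= X - I + h.
Proof.
move=> eX eY N2 N1 eh eI m1_0 m2_0 h0 /andP[X0 XN] /andP[Y0 YN].
have e1 : m1 = M1 * h by apply/eqP; rewrite -(eqn_pmul2r m2_0) eh N1 mulnAC.
have e2 : m2 = M2 * h by apply/eqP; rewrite -(eqn_pmul2l m1_0) eh N2; apply/eqP; lia.
have N0 : 0 < N by lia.
have e3 : I = h * (a * b).
  apply/eqP; rewrite -(eqn_pmul2r N0) eI eX eY; apply/eqP.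
  by rewrite (_ : _ * _ = a * b * (m1 * m2)) ?eh; lia.
have aM : 0 < a < M2.
  by move: X0 XN; rewrite eX N2 muln_gt0 ltn_pmul2r // m1_0 andbT => -> ->.
have bM : 0 < b <= M1.
  by move: Y0 YN; rewrite eY N1 muln_gt0 leq_pmul2r // m2_0 andbT => -> ->.
have -> : Y - I = h * (b * (M2 - a)) by rewrite eY e2 e3; nia.
have -> : X - I = h * (a * (M1 - b)) by rewrite eX e1 e3; nia.
by rewrite {1}e1 {1}e2; apply: grid_missing_rows_count.
Qed.

Section Kneser.
Import GroupScope.
Variables (gT : finGroupType) (G : {group gT}).
Hypothesis cGG : abelian G.
Implicit Types (A B C S X Y : {set gT}) (H K : {group gT}).

Lemma abelian_mulC : {in G &, commutative mulg}.
Proof. by move=> x y Gx Gy; apply: (centsP cGG). Qed.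

Lemma mulsgC A B : A \subset G -> B \subset G -> A * B = B * A.
Proof. by move=> sA sB; apply/centC/(centSS sA sB cGG). Qed.

Lemma mulsG_mulsG A B H :
  B \subset G -> H \subset G -> A * H * (B * H) = A * B * H.
Proof.
by move=> sB sH; rewrite -!mulgA (mulgA H) (mulsgC sH sB) -mulgA mulGid.
Qed.

Lemma period_group_set S : group_set (period G S).
Proof.
apply/group_setP; split=> [|x y]; first by rewrite inE group1 mulg1 eqxx.
rewrite !inE => /andP[Gx /eqP Sx] /andP[Gy /eqP Sy].
by rewrite groupM //= rcosetM Sx Sy.
Qed.
Canonical period_group S := group (period_group_set S).

Lemma period_sub S : period G S \subset G.
Proof. by apply/subsetP=> x; rewrite inE => /andP[]. Qed.

Lemma mul_period S : S * period G S = S.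
Proof.
apply/eqP; rewrite eqEsubset mulg_subl ?group1 // andbT.
apply/subsetP=> _ /mulsgP[x y Sx Py ->].
by move: Py; rewrite inE => /andP[_ /eqP <-]; rewrite mem_rcoset mulgK.
Qed.

Lemma sub_period H S : H \subset G -> S * H = S -> H \subset period G S.
Proof.
move=> sHG SH; apply/subsetP=> h Hh; rewrite inE (subsetP sHG) //=.
rewrite eqEcard card_rcoset leqnn andbT -{2}SH.
by rewrite mulgS ?sub1set.
Qed.

Lemma period_subset_mull S A :
  S \subset G -> A \subset G -> period G S \subset period G (S * A).
Proof.
move=> sS sA; apply: sub_period; first exact: period_sub.
by rewrite -mulgA (mulsgC sA (period_sub S)) mulgA mul_period.
Qed.

Lemma periodIU X Y : period G X :&: period G Y \subset period G (X :|: Y).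
Proof.
apply/subsetP=> g; rewrite !inE => /andP[/andP[-> /eqP Xg] /andP[_ /eqP Yg]].
by rewrite /= mulUg Xg Yg.
Qed.

Lemma abelian_sub_norm A H : A \subset G -> H \subset G -> A \subset 'N(H).
Proof. by move=> sA sH; rewrite cents_norm // (centSS sA sH cGG). Qed.

Lemma card_mul_quotient A H :
  A \subset G -> H \subset G -> #|A * H| = (#|A / H| * #|H|)%N.
Proof.
move=> sA sH; rewrite (mulsgC sA sH) -quotientK ?abelian_sub_norm //.
exact: card_cosetpre_set.
Qed.

Lemma dvdn_card_periodic S H :
  S \subset G -> H \subset G -> S * H = S -> #|H| %| #|S|.
Proof. by move=> sS sH <-; rewrite card_mul_quotient // dvdn_mull. Qed.

Lemma periodicI S H x (K : {group gT}) :
  S * H = S -> H \subset K -> (S :&: x *: K) * H = S :&: x *: K.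
Proof.
move=> SH sHK; apply/eqP; rewrite eqEsubset mulg_subl ?group1 // andbT.
apply/subsetP=> _ /mulsgP[y h /setIP[Sy xKy] Hh ->]; rewrite inE -{1}SH mem_mulg //=.
by move: xKy; rewrite !mem_lcoset mulgA => ?; rewrite groupM // (subsetP sHK).
Qed.

(* The average of [#|X :&: Y k|] over k in H1H2 is [#|X| #|Y| / #|H1H2|],
   and all its terms are equal. *)
Lemma card_periodicI (H1 H2 : {group gT}) X Y x :
    H1 \subset G -> H2 \subset G -> X * H1 = X -> Y * H2 = Y ->
    X \subset G -> Y \subset G ->
    X \subset x *: (H1 * H2) -> Y \subset x *: (H1 * H2) ->
  (#|X :&: Y| * #|(H1 * H2)%g| = #|X| * #|Y|)%N.
Proof.
move=> sH1 sH2 XH YH sXG sYG sX sY.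
have gK : group_set (H1 * H2) by apply/comm_group_setP/mulsgC.
pose K := group gK.
(* For [k = h1 h2], periodicity makes [X :&: Y :* k] the translate of [X :&: Y] by [h1]. *)
have tr k : k \in K -> #|X :&: Y :* k| = #|X :&: Y|.
  case/mulsgP=> h1 h2 Hh1 Hh2 ->.
  have [Gh1 Gh2] : h1 \in G /\ h2 \in G by rewrite (subsetP sH1) ?(subsetP sH2).
  rewrite -(card_rcoset (X :&: Y) h1) /rcoset.
  apply: eq_card => z; rewrite inE !mem_rcoset inE invMg !mulgA.
  congr (_ && _).
    apply/idP/idP => ?; first by rewrite -XH mem_mulg ?groupV.
    by rewrite -(mulgKV h1 z) -XH mem_mulg.
  have Hh2' : h2^-1 \in H2 by rewrite groupV.
  case: (boolP (z \in G)) => Gz; last first.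
    rewrite [LHS](contraNF _ Gz) ?[RHS](contraNF _ Gz) // => /(subsetP sYG).
      by rewrite groupMr ?groupV.
    by rewrite !groupMr ?groupV.
  have -> : z * h2^-1 * h1^-1 = z * h1^-1 * h2^-1.
    by rewrite -!mulgA (abelian_mulC (x:= h2^-1)) ?groupV.
  apply/idP/idP => ?; last by rewrite -YH mem_mulg ?groupV.
  by rewrite -(mulgKV h2 (z * h1^-1)) -YH mem_mulg.
rewrite mulnC -[LHS]sum_nat_const -[RHS]sum_nat_const.
rewrite -(eq_bigr _ tr).
transitivity (\sum_(k in K) \sum_(a in X) nat_of_bool ((a * k^-1)%g \in Y)).
  apply: eq_bigr => k Kk; rewrite -sum1_card big_mkcond [RHS]big_mkcond /=.
  apply: eq_bigr => a _; rewrite inE mem_rcoset.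
  by case: (a \in X) => //=; case: (_ \in Y).
rewrite exchange_big; apply: eq_bigr => a Xa.
rewrite -big_mkcondr sum1_card -[RHS](card_imset _ (inj_comp (mulIg a) (@invg_inj gT))).
apply: eq_card => k; apply/andP/imsetP => [[Kk Yk]|[y Yy ->]] /=.
  by exists (a * k^-1) => //; rewrite /= invMg invgK mulgKV.
have Ky : x^-1 * y \in K by rewrite -mem_lcoset (subsetP sY).
have Ka : x^-1 * a \in K by rewrite -mem_lcoset (subsetP sX).
split; last by rewrite invMg invgK mulgA mulgV mul1g.
by have := groupM (groupVr Ky) Ka; rewrite invMg invgK !mulgA mulgK.
Qed.

(** Both sets are cut with the coset of [H1 * H2] through [x]. If [C1] misses it, [x *: H2] lies in
    [C2 :\: C1]. Otherwise the traces are unions of rows and of columns, some row being absent since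
    [x] is not in [C1], and the grid count applies. *)
Lemma coset_period_dichotomy (H1 H2 : {group gT}) C1 C2 x :
    H1 \subset G -> H2 \subset G -> C1 * H1 = C1 -> C2 * H2 = C2 ->
    C1 \subset G -> C2 \subset G -> x \in C2 :\: C1 ->
  [\/ #|H2| <= #|C2 :\: C1|, #|H1| <= #|C2 :\: C1| + #|H1 :&: H2|
    | #|H2| <= #|C1 :\: C2| + #|H1 :&: H2| ]%N.
Proof.
move=> sH1 sH2 CH1 CH2 sC1 sC2 /setDP[C2x notC1x].
have gK : group_set (H1 * H2) by apply/comm_group_setP/mulsgC.
pose K := group gK.
have [sH1K sH2K] : H1 \subset K /\ H2 \subset K by rewrite mulG_subl mulG_subr.
have sKG : K \subset G by rewrite mul_subG.
pose X := C1 :&: x *: K; pose Y := C2 :&: x *: K.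
have Yx : x \in Y by rewrite inE C2x lcoset_refl.
have XH : X * H1 = X by apply: periodicI.
have YH : Y * H2 = Y by apply: periodicI.
have sXG : X \subset G by rewrite subIset ?sC1.
have sYG : Y \subset G by rewrite subIset ?sC2.
have cXY := card_periodicI sH1 sH2 XH YH sXG sYG (subsetIr _ _) (subsetIr _ _).
have [X0 | [x1 Xx1]] := set_0Vmem X.
  apply: Or31; rewrite -(card_lcoset H2 x); apply/subset_leq_card/subsetP=> y H2y.
  have C2y : y \in C2.
    by rewrite -CH2; move: H2y; rewrite mem_lcoset => ?; rewrite -(mulKVg x y) mem_mulg.
  rewrite inE C2y andbT; apply: contraFN (in_set0 y) => C1y; rewrite -X0 inE C1y.
  by apply: subsetP H2y; rewrite mulgS.
have ltX : (#|X| < #|K|)%N.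
  rewrite -(card_lcoset K x) proper_card // properE subsetIr; apply/subsetPn.
  by exists x; rewrite ?lcoset_refl // inE (negPf notC1x).
have leY : (#|Y| <= #|K|)%N by rewrite -(card_lcoset K x) subset_leq_card ?subsetIr.
have sYX : (#|Y| - #|X :&: Y| <= #|C2 :\: C1|)%N.
  rewrite setIC -cardsD subset_leq_card //; apply/subsetP=> z; rewrite !inE.
  by case: (z \in C2); case: (z \in C1); case: (z \in x *: K).
have sXY : (#|X| - #|X :&: Y| <= #|C1 :\: C2|)%N.
  rewrite -cardsD subset_leq_card //; apply/subsetP=> z; rewrite !inE.
  by case: (z \in C2); case: (z \in C1); case: (z \in x *: K).
have [/dvdnP[a Xa] /dvdnP[b Yb]] :=
  (dvdn_card_periodic sXG sH1 XH, dvdn_card_periodic sYG sH2 YH).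
have [/dvdnP[M2 KM2] /dvdnP[M1 KM1]] := (cardSg sH1K, cardSg sH2K).
have X_gt0 : (0 < #|X|)%N by apply/card_gt0P; exists x1.
have Y_gt0 : (0 < #|Y|)%N by apply/card_gt0P; exists x.
have [] := @grid_periodic_count
    #|K| #|H1| #|H2| #|H1 :&: H2| a b M1 M2 #|X| #|Y| #|X :&: Y|;
  rewrite ?X_gt0 ?Y_gt0 ?cardG_gt0 ?ltX ?leY //.
- exact: mul_cardG.
- by move=> le; apply: Or32; rewrite (leq_trans le) // leq_add2r.
- by move=> le; apply: Or33; rewrite (leq_trans le) // leq_add2r.
Qed.

(** The dichotomy is used at a point of each difference. Its last two alternatives suffice alone,
    since the union keeps the common periods; if both uses give the first one, adding the two
    inequalities yields twice the bound. *)
Lemma period_setU_bound m C1 C2 :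
    C1 \subset G -> C2 \subset G ->
    m <= #|C1| + #|period G C1| -> m <= #|C2| + #|period G C2| ->
  m <= #|C1 :|: C2| + #|period G (C1 :|: C2)|.
Proof.
move=> sC1 sC2 m1 m2.
have [sC12 | /subsetPn[x1 C1x notC2x]] := boolP (C1 \subset C2).
  by rewrite (setUidPr sC12).
have [sC21 | /subsetPn[x2 C2x notC1x]] := boolP (C2 \subset C1).
  by rewrite (setUidPl sC21).
have leP := subset_leq_card (periodIU C1 C2).
have C1E : #|C1 :|: C2| = #|C1| + #|C2 :\: C1|.
  by rewrite cardsU -[#|C2|](cardsID C1) (setIC C2) addnCA addKn.
have C2E : #|C1 :|: C2| = #|C2| + #|C1 :\: C2|.
  by rewrite cardsU addnC -[#|C1|](cardsID C2) addnCA addKn.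
have [sP1 sP2] := (period_sub C1, period_sub C2).
have D21 : x2 \in C2 :\: C1 by rewrite inE notC1x.
have D12 : x1 \in C1 :\: C2 by rewrite inE notC2x.
have := coset_period_dichotomy sP1 sP2 (mul_period C1) (mul_period C2) sC1 sC2 D21.
have := coset_period_dichotomy sP2 sP1 (mul_period C2) (mul_period C1) sC2 sC1 D12.
rewrite (setIC (period_group C2)) /=.
rewrite C1E in C2E *; move: leP m1 m2.
move: C2E; move: #|C1| #|C2| #|C2 :\: C1| #|C1 :\: C2| #|_ :&: _|.
move: #|period G C1| #|period G C2| #|period G _|; clear.
by move=> p1 p2 p c1 c2 d21 d12 h C2E leP m1 m2 [] ? [] ?; lia.
Qed.

(* A Dyson transform of the pair around an element e with [e *: B] not inside A
   shrinks B, keeps 1 in both sets and does not enlarge the product set. *)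
Lemma Dyson_periodic_subset A B :
    A \subset G -> B \subset G -> 1 \in A -> 1 \in B ->
  exists2 C : {set gT}, (1 \in C) && (C \subset A * B) &
    #|A| + #|B| <= #|C| + #|period G C|.
Proof.
have [n] := ubnP #|B|; elim: n A B => // n IHn A B ltBn sA sB A1 B1.
have [sAB | /subsetPn[_ /mulsgP[e b Ae Bb ->] notAeb]] := boolP (A * B \subset A).
  (* When [A * B] is inside [A], every element of [B] is a period of [A]. *)
  exists A; first by rewrite A1 mulg_subl.
  rewrite leq_add2l subset_leq_card //; apply/subsetP=> b Bb.
  rewrite inE (subsetP sB) //= eqEcard card_rcoset leqnn andbT.
  by apply: subset_trans sAB; rewrite mulgS ?sub1set.
have Ge : e \in G by apply: (subsetP sA).
pose A' := A :|: e *: B; pose B' := B :&: e^-1 *: A.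
have cAB : #|A'| + #|B'| = #|A| + #|B|.
  rewrite -(card_lcoset B' e) -(card_lcoset B e) -(cardsUI A (e *: B)); congr (_ + _).
  by apply: eq_card => y; rewrite inE !mem_lcoset !inE mem_lcoset invgK mulKVg andbC.
have ltB : #|B'| < #|B|.
  rewrite proper_card // properE subsetIl; apply/subsetPn; exists b => //.
  by rewrite inE Bb mem_lcoset invgK.
have [||||| C /andP[C1 sC] leC] := IHn A' B'.
- exact: leq_trans ltB _.
- rewrite subUset sA; apply/subsetP=> y; rewrite mem_lcoset => /(subsetP sB).
  by rewrite groupMl ?groupV.
- by rewrite subIset ?sB.
- by rewrite inE A1.
- by rewrite inE B1 mem_lcoset invgK mulg1.
exists C; last by rewrite -cAB.
rewrite C1 (subset_trans sC) //; apply/subsetP=> _ /mulsgP[x y A'x B'y ->].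
case/setIP: B'y => By; rewrite mem_lcoset invgK => Aey.
case/setUP: A'x => [Ax | ]; first exact: mem_mulg.
rewrite mem_lcoset => Bx; rewrite -(mulKVg e x) -mulgA.
have [Gx Gy] : e^-1 * x \in G /\ y \in G by rewrite !(subsetP sB).
by rewrite (abelian_mulC Gx Gy) mulgA mem_mulg.
Qed.

Theorem Kneser A B :
    A \subset G -> B \subset G -> A != set0 -> B != set0 ->
  #|A| + #|B| <= #|(A * B)%g| + #|period G (A * B)|.
Proof.
move=> sA sB /set0Pn[a0 Aa0] /set0Pn[b0 Bb0].
have sAB : A * B \subset G by rewrite mul_subG.
have near c : c \in A * B ->
    exists2 C : {set gT}, (c \in C) && (C \subset A * B) &
      #|A| + #|B| <= #|C| + #|period G C|.
  case/mulsgP=> a b Aa Bb ->.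
  have [Ga Gb] : a \in G /\ b \in G by rewrite (subsetP sA) ?(subsetP sB).
  have tr (D : {set gT}) y : D \subset G -> y \in G -> y^-1 *: D \subset G.
    by move=> sD Gy; rewrite mul_subG ?sub1set ?groupV.
  have [|||| C /andP[C1 sC]] := @Dyson_periodic_subset (a^-1 *: A) (b^-1 *: B).
  - exact: tr.
  - exact: tr.
  - by rewrite mem_lcoset invgK mulg1.
  - by rewrite mem_lcoset invgK mulg1.
  rewrite !card_lcoset => leC.
  have sCG : C \subset G by apply: subset_trans sC _; rewrite mul_subG ?tr.
  exists ((a * b) *: C).
    rewrite mem_lcoset mulVg C1; apply/subsetP=> y; rewrite mem_lcoset.
    case/(subsetP sC)/mulsgP=> x z; rewrite !mem_lcoset !invgK => Ax Bz.
    move/(canRL (mulKVg _)) ->.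
    have [Gx Gz] : x \in G /\ z \in G.
      by rewrite -(groupMl x Ga) -(groupMl z Gb) (subsetP sA) ?(subsetP sB).
    rewrite (_ : a * b * (x * z) = a * x * (b * z)); first exact: mem_mulg.
    by rewrite !mulgA -(mulgA a b x) (abelian_mulC Gb Gx) !mulgA.
  rewrite card_lcoset (leq_trans leC) // leq_add2l subset_leq_card //.
  apply: sub_period; first exact: period_sub.
  by rewrite -mulgA mul_period.
pose ok C := (C \subset A * B) && (#|A| + #|B| <= #|C| + #|period G C|).
have [C0 /andP[_ sC0] leC0] := near _ (mem_mulg Aa0 Bb0).
have ok0 : ok C0 by rewrite /ok sC0.
have [C /maxsetP[/andP[sC leC] maxC] _] := maxset_exists ok0.
suff -> : A * B = C by [].
apply/eqP; rewrite eqEsubset sC andbT; apply/subsetP=> c ABc.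
have [D /andP[Dc sD] leD] := near _ ABc.
rewrite -(maxC (C :|: D)) ?subsetUl ?inE ?Dc ?orbT // /ok subUset sC sD /=.
by apply: period_setU_bound; rewrite // (subset_trans _ sAB).
Qed.

(** With [H] the period of the cube, Kneser's bounds for [A * H] with itself and for [A * A * H]
    with [A * H] are added. Multiplication only enlarges periods, so that of [A * A * H] has order
    at most [#|H|]. *)
Corollary Kneser_cube A :
    A \subset G -> A != set0 ->
  (3 * #|(A * period G (A * A * A))%g|
     <= #|(A * A * A)%g| + 2 * #|period G (A * A * A)%g|)%N.
Proof.
move=> sA A_neq0; set H := period G _.
have sH : H \subset G := period_sub _.
have sAH : A * H \subset G by rewrite mul_subG.
have AHn0 : A * H != set0.
  by have /set0Pn[a Aa] := A_neq0; apply/set0Pn; exists (a * 1); rewrite mem_mulg ?group1.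
have AHA (D : {set gT}) : D * H * (A * H) = D * A * H by apply: mulsG_mulsG.
have sAA : A * A \subset G by rewrite mul_subG.
have K2 := Kneser sAH sAH AHn0 AHn0.
have AAHn0 : A * A * H != set0.
  have /set0Pn[a AHa] := AHn0; apply/set0Pn; exists (a * a).
  by rewrite -AHA // mem_mulg.
have sAAH : A * A * H \subset G by rewrite mul_subG.
have K3 := Kneser sAAH sAH AAHn0 AHn0.
have A3H : A * A * A * H = A * A * A by apply: mul_period.
have P3 : period G (A * A * H * (A * H)) = H by rewrite AHA // A3H.
have P2 : #|period G (A * A * H)| <= #|H|.
  by have := period_subset_mull sAAH sAH; rewrite P3; apply: subset_leq_card.
move: P2 K2 K3; rewrite P3 !AHA // A3H.
by move: #|A * H| #|A * A * H| #|A * A * A| #|H| #|period G _|; clear => *; lia.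
Qed.

End Kneser.

(** * Sum-free sets in elementary abelian 2-groups *)

(** A computable quantifier, so that all vertex sets of a 16-vertex graph can be checked by
    evaluation. *)
Fixpoint all_bits (n : nat) (P : seq bool -> bool) : bool :=
  if n is n'.+1 then
    all_bits n' (fun l => P (true :: l)) && all_bits n' (fun l => P (false :: l))
  else P [::].

Lemma all_bitsP n P l : all_bits n P -> size l = n -> P l.
Proof.
elim: n P l => [|n IHn] P [|b l] //= /andP[Pt Pf] [sl].
by case: b; [apply: (IHn (fun l => P (true :: l)))
            | apply: (IHn (fun l => P (false :: l)))].
Qed.

(* The Clebsch graph: 16 vertices, edges along the four axes of the 4-cube and
   between antipodes.  Bit [k] of the index of a vertex is its [k]-th coordinate. *)
Definition Clebsch_edges : seq (nat * nat) :=
  [seq (i, j) | i <- iota 0 16,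
                j <- [seq j <- iota 0 16 |
     let d k := odd (i %/ 2 ^ k) != odd (j %/ 2 ^ k) in
     let e := d 0 + d 1 + d 2 + d 3 in (e == 1) || (e == 4)]].

Definition Clebsch_values (f : bool -> bool -> bool -> bool -> bool) : seq bool :=
  [seq f (odd i) (odd (i %/ 2)) (odd (i %/ 4)) (odd (i %/ 8)) | i <- iota 0 16].

Lemma Clebsch_independence l :
    size l = 16 ->
    all (fun ij => ~~ (nth false l ij.1 && nth false l ij.2)) Clebsch_edges ->
  count id l <= 5.
Proof.
move=> sl indl; apply: implyP indl.
pose P l := all (fun ij => ~~ (nth false l ij.1 && nth false l ij.2)) Clebsch_edges
              ==> (count id l <= 5).
apply: (@all_bitsP 16 P) sl; by vm_compute.
Qed.

(** [f] is the indicator of a vertex set: four hypotheses exclude axis edges, the fifth antipodal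
    pairs. *)
Lemma Clebsch_function_bound (f : bool -> bool -> bool -> bool -> bool) :
    (forall p q r s, ~~ (f p q r s && f (~~ p) q r s)) ->
    (forall p q r s, ~~ (f p q r s && f p (~~ q) r s)) ->
    (forall p q r s, ~~ (f p q r s && f p q (~~ r) s)) ->
    (forall p q r s, ~~ (f p q r s && f p q r (~~ s))) ->
    (forall p q r s, ~~ (f p q r s && f (~~ p) (~~ q) (~~ r) (~~ s))) ->
  count id (Clebsch_values f) <= 5.
Proof.
move=> f1 f2 f3 f4 f5; apply: Clebsch_independence => //.
have : Clebsch_edges = ltac:(let e := eval vm_compute in Clebsch_edges in exact e).
  by vm_compute.
move=> ->; rewrite /=.
repeat (apply/andP; split;
  [first [exact: f1 | exact: f2 | exact: f3 | exact: f4 | exact: f5] | ]).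
done.
Qed.

Section ElementaryTwoGroup.
Import GroupScope.
Variables (gT : finGroupType) (E : {group gT}).
Hypothesis expE : exponent E %| 2.
Implicit Types A B : {set gT}.

Let cEE : abelian E.
Proof. exact: abelem_abelian (exponent2_abelem expE). Qed.

Let mulEE x : x \in E -> x * x = 1.
Proof. by move=> Ex; have := exponentP expE x Ex; rewrite expgS expg1. Qed.

(** The products of subfamilies of [a1], ..., [a4] label the 4-cube, and the relation makes [a5] the
    step to the antipode. As [B] is sum-free, each translate has at most 5 of its 16 labels in [B];
    averaging over the translates gives the bound, even if labels coincide. *)
Lemma sum_free_relation_bound B a1 a2 a3 a4 a5 :
    B \subset E -> {in B &, forall x y, x * y \notin B} ->
    a1 \in B -> a2 \in B -> a3 \in B -> a4 \in B -> a5 \in B ->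
    a1 * a2 * a3 = a4 * a5 ->
  (16 * #|B| <= 5 * #|E|)%N.
Proof.
move=> sBE sfB Ba1 Ba2 Ba3 Ba4 Ba5 rel.
have BE y : y \in B -> y \in E by apply: subsetP.
have step a y : a \in B -> y \in E -> ~~ ((y \in B) && (y * a \in B)).
  move=> Ba Ey; apply/andP=> [[By Bya]]; have := sfB _ _ By Bya.
  by rewrite mulgA mulEE // mul1g Ba.
have EX a (p : bool) : a \in B -> a ^+ p \in E by move=> /BE; apply: groupX.
have flip u a w (p : bool) : a \in B -> w \in E ->
    u * a ^+ (~~ p) * w = u * a ^+ p * w * a.
  move=> Ba Ew; have Ea := BE _ Ba.
  rewrite -!mulgA (abelian_mulC cEE Ew Ea) !mulgA; case: p; rewrite /= mulg1 ?expg1 //.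
  by rewrite -(mulgA u) mulEE // mulg1.
pose v (p q r s : bool) := a1 ^+ p * a2 ^+ q * a3 ^+ r * a4 ^+ s.
have Ev p q r s : v p q r s \in E by rewrite !groupM ?EX.
have v1 p q r s : v (~~ p) q r s = v p q r s * a1.
  have := flip 1 a1 (a2 ^+ q * a3 ^+ r * a4 ^+ s) p Ba1.
  by rewrite /v !mul1g !mulgA => ->; rewrite ?groupM ?EX.
have v2 p q r s : v p (~~ q) r s = v p q r s * a2.
  have := flip (a1 ^+ p) a2 (a3 ^+ r * a4 ^+ s) q Ba2.
  by rewrite /v !mulgA => ->; rewrite ?groupM ?EX.
have v3 p q r s : v p q (~~ r) s = v p q r s * a3.
  by rewrite /v (flip (a1 ^+ p * a2 ^+ q) a3 (a4 ^+ s) r Ba3) ?groupM ?EX.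
have v4 p q r s : v p q r (~~ s) = v p q r s * a4.
  by have := flip (a1 ^+ p * a2 ^+ q * a3 ^+ r) a4 1 s Ba4; rewrite /v !mulg1 => ->.
have v5 p q r s : v (~~ p) (~~ q) (~~ r) (~~ s) = v p q r s * a5.
  rewrite v4 v3 v2 v1; have <- : a1 * a2 * a3 * a4 = a5; last by rewrite !mulgA.
  by rewrite rel (abelian_mulC cEE (BE _ Ba4) (BE _ Ba5)) -mulgA mulEE ?mulg1 ?BE.
clearbody v.
pose f x p q r s := x * v p q r s \in B.
have bound x : x \in E -> (count id (Clebsch_values (f x)) <= 5)%N.
  move=> Ex; apply: Clebsch_function_bound => p q r s; rewrite /f ?v5 ?v4 ?v3 ?v2 ?v1;
    by rewrite mulgA step // groupM.
have tr c : c \in E -> \sum_(x in E) nat_of_bool (x * c \in B)%g = #|B|.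
  move=> Ec; rewrite -big_mkcondr sum1_card -(card_rcoset B c^-1).
  apply: eq_card => x; rewrite mem_rcoset invgK; apply/andP/idP => [[] // | Bxc].
  by split=> //; rewrite -(groupMr x Ec) BE.
have -> : (16 * #|B|)%N = \sum_(x in E) count id (Clebsch_values (f x)).
  rewrite /Clebsch_values /= /f !big_split /= !tr // big1 //; lia.
by rewrite mulnC -sum_nat_const; apply: leq_sum.
Qed.

(** For [g] outside the cube, [B = g *: A] is disjoint from [A * A = B * B], and by Kneser's bound
    the two partition [E]. A product of three elements of [B] lying in [A * A] contradicts the
    Clebsch bound. If there is none, such products stay in [B], so products of two elements of [A]
    are periods of [A], hence trivial. *)
Lemma exponent2_cube_critical A :
    A \subset E -> 1 \in A -> A * A * A != E -> period E (A * A * A) = 1 ->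
  (3 * #|A| = #|E| + 1)%N -> A = 1.
Proof.
move=> sA A1 cubeA perA cardA.
have AE y : y \in A -> y \in E by apply: subsetP.
have sA2 : A * A \subset E by rewrite mul_subG.
have sA3 : A * A * A \subset E by rewrite mul_subG.
have [g Eg notA3g] : exists2 g, g \in E & g \notin A * A * A.
  by apply/subsetPn; rewrite eqEsubset sA3 in cubeA.
have vE y : y \in E -> y^-1 = y.
  by move=> Ey; apply: (mulgI y); rewrite mulgV mulEE.
have gg u w : u \in E -> g * u * (g * w) = u * w.
  move=> Eu; rewrite mulgA (abelian_mulC cEE (groupM Eg Eu) Eg) (mulgA g g) mulEE //.
  by rewrite mul1g.
pose B := g *: A.
have sB : B \subset E by rewrite mul_subG ?sub1set.
have B2 x y : x \in B -> y \in B -> x * y \in A * A.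
  rewrite !mem_lcoset vE // => Ax Ay.
  have Ex : x \in E by rewrite -(groupMl x Eg) AE.
  by rewrite -(gg x y) //; apply: mem_mulg.
have dis y : y \in A * A -> y \notin B.
  apply: contraTN; rewrite mem_lcoset vE // => Agy; apply: contraNN notA3g => A2y.
  have Ey := subsetP sA2 _ A2y.
  by rewrite -(mulgK y g) vE // (abelian_mulC cEE (groupM Eg Ey) Ey) mem_mulg.
have A_neq0 : A != set0 by apply/set0Pn; exists 1.
have perA2 : period E (A * A) = 1.
  by apply/trivgP; rewrite -perA (period_subset_mull cEE).
have := Kneser cEE sA sA A_neq0 A_neq0; rewrite perA2 cards1 => K2.
have cover x : x \in E -> (x \in A * A) || (x \in B).
  move=> Ex; rewrite -in_setU; suff -> : A * A :|: B = E by [].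
  apply/eqP; rewrite eqEcard subUset sA2 sB cardsU disjoint_setI0.
    rewrite cards0 subn0 card_lcoset; move: cardA K2.
    by move: #|A| #|A * A| #|E|; clear; lia.
  by rewrite disjoint_subset; apply/subsetP=> y /dis.
have Bg z : z \in A -> g * z \in B by rewrite mem_lcoset mulKg.
have [rel | norel] := boolP [exists t : gT * gT * gT,
   [&& t.1.1 \in B, t.1.2 \in B, t.2 \in B & t.1.1 * t.1.2 * t.2 \in A * A]].
  have [[[a1 a2] a3] /and4P[/= Ba1 Ba2 Ba3]] := existsP rel.
  case/mulsgP=> x y Ax Ay rel5.
  (* Here [#|E|] is [3 * #|A| - 1], and [16 * #|A| <= 15 * #|A| - 5] fails. *)
  have [] : ~ (16 * #|B| <= 5 * #|E|)%N.
    by rewrite card_lcoset; move: cardA; move: #|A| #|E|; clear; lia.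
  apply: (sum_free_relation_bound sB _ Ba1 Ba2 Ba3 (Bg _ Ax) (Bg _ Ay)).
    by move=> u w Bu Bw; apply/dis/B2.
  by rewrite rel5 mulgA (abelian_mulC cEE (groupM Eg (AE _ Ax)) Eg) !mulgA mulEE ?mul1g.
have mulA2 x y : x \in A -> y \in A -> x * y \in period E A.
  move=> Ax Ay; have [Ex Ey] := (AE _ Ax, AE _ Ay).
  rewrite inE groupM //= eqEcard card_rcoset leqnn andbT.
  apply/subsetP=> z; rewrite mem_rcoset => Az.
  set w := z * _ in Az; have Ew := AE _ Az.
  (* Two factors [g] cancel, leaving [g * z]; being outside [A * A] it lies in [B], so [z] is in
     [A]. *)
  have : g * w * (g * x) * (g * y) \notin A * A.
    apply: contraNN norel => A2t; apply/existsP; exists (g * w, g * x, g * y).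
    by rewrite /= !Bg.
  have -> : g * w * (g * x) * (g * y) = g * z.
    by rewrite -(mulgA (g * w)) gg // -mulgA /w mulgKV.
  move=> notA2; have := cover (g * z); rewrite (negPf notA2) mem_lcoset mulKg /=.
  apply; rewrite groupM // -(mulgKV (x * y) z) groupM // groupM //.
have perE : period E A = 1.
  by apply/trivgP; rewrite -perA -mulgA (period_subset_mull cEE).
apply/eqP; rewrite eqEsubset sub1set A1 andbT; apply/subsetP=> x Ax.
by have := mulA2 x 1 Ax A1; rewrite perE mulg1.
Qed.

End ElementaryTwoGroup.

(** * Sets whose threefold product is not the whole group *)

Section UpperBounds.
Import GroupScope.
Variables (gT : finGroupType) (G : {group gT}).
Implicit Types (A B : {set gT}).

Lemma sumpowE A n : sumpow A n = (1 |: A) ^+ n.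
Proof. by elim: n => // n IHn; rewrite expgSr -IHn. Qed.

Lemma sumpow3 A : 1 \in A -> sumpow A 3 = A * A * A.
Proof. by move=> A1; rewrite sumpowE (setUidPr _) ?sub1set // !expgS expg0 mulg1 mulgA. Qed.

Lemma sumpow_sub A n : A \subset G -> sumpow A n \subset G.
Proof.
move=> sA; elim: n => [|n IHn]; first exact: sub1G.
by rewrite /= mul_subG // subUset sub1G.
Qed.

Lemma sumpow_mono A m n : m <= n -> sumpow A m \subset sumpow A n.
Proof.
move/subnK <-; elim: (n - m) => // k IHk; apply: subset_trans IHk _.
by rewrite /= mulg_subl ?setU11.
Qed.

Lemma diam_ge4E A : A \subset G -> diam_ge G A 4 = (sumpow A 3 != G).
Proof.
move=> sA; apply/forallP/idP => [dA | A3 k]; first exact: (dA ord_max).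
apply: contraNneq A3 => Ak; rewrite eqEsubset sumpow_sub // -Ak.
by apply: sumpow_mono; rewrite -ltnS.
Qed.

Lemma sumpow_subset_gen A n : sumpow A n \subset <<A>>.
Proof.
elim: n => [|n IHn]; first exact: sub1G.
by rewrite /= mul_subG // subUset sub1G subset_gen.
Qed.

Lemma diam_finiteE A : A \subset G -> diam_finite G A = (<<A>> == G).
Proof.
move=> sA; rewrite /diam_finite /asbool.
case: ClassicalEpsilon.excluded_middle_informative => [[k Ak] | noA]; apply/esym.
  by rewrite eqEsubset gen_subG sA -{1}Ak sumpow_subset_gen.
apply/eqP=> genA; case: noA; have [n An] := gen_expgs A.
by exists n; rewrite sumpowE -An.
Qed.

(** The sets [sumpow A k] grow strictly until they stabilize, which happens only at [<<A>> = G]. So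
    the proper subset [sumpow A 3] has at least four elements. *)
Lemma diam_plus_ge4_card : diam_plus_ge G 4 -> 4 < #|G|.
Proof.
case=> A [sA genA]; rewrite diam_ge4E // => A3.
have grow k : (k < #|sumpow A k|) || (sumpow A k == G).
  elim: k => [|k IHk]; first by rewrite /= cards1.
  have sk := sumpow_mono A (leqnSn k).
  have [eqk | neqk] := eqVneq (sumpow A k) (sumpow A k.+1).
    have stable n : sumpow A (n + k) = sumpow A k.
      by elim: n => // n IHn; rewrite addSn /= IHn -[LHS]/(sumpow A k.+1).
    suff -> : sumpow A k.+1 == G by rewrite orbT.
    rewrite -eqk eqEsubset sumpow_sub //= -{1}genA.
    have [n ->] := gen_expgs A; rewrite -sumpowE -(stable n) sumpow_mono ?leq_addr //.
  case/orP: IHk => [ltk | /eqP kG].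
    by rewrite (leq_ltn_trans ltk) // proper_card // properEneq neqk.
  by rewrite eqEsubset sumpow_sub // -kG sk orbT.
have := grow 3; rewrite (negPf A3) orbF => /leq_ltn_trans; apply.
by rewrite proper_card // properEneq A3 sumpow_sub.
Qed.

Hypothesis cGG : abelian G.

Section Cube.
Variable A : {set gT}.
Hypotheses (sA : A \subset G) (A3G : A * A * A != G).
Let H := period_group G (A * A * A).

Let sHG : H \subset G. Proof. exact: period_sub. Qed.
Let sA3 : A * A * A \subset G. Proof. by rewrite !mul_subG. Qed.

(** The cube is a proper union of cosets of [H], so its image has at most [#|G / H| - 1] elements;
    [Kneser_cube] is divided by [#|H|]. *)
Lemma cube_quotient_bound : 3 * #|A / H| <= #|G / H| + 1.
Proof.
have [-> | A_neq0] := eqVneq A set0.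
  by rewrite quotient0 cards0.
have H0 := cardG_gt0 H.
have cG : #|G| = (#|G / H| * #|H|)%N.
  by rewrite -(card_mul_quotient cGG) ?mulGSid.
have c3 : #|(A * A * A)%g| = (#|(A * A * A)%g / H| * #|H|)%N.
  by rewrite -(card_mul_quotient cGG) // mul_period.
have lt3 : #|(A * A * A)%g| < #|G| by rewrite proper_card // properEneq A3G.
have := Kneser_cube cGG sA A_neq0; rewrite -[period G _]/(H : {set gT}).
rewrite (card_mul_quotient cGG) // c3.
move: lt3; rewrite cG c3 ltn_pmul2r //.
move: H0; move: #|A / H| #|G / H| #|_ / H| #|H| => q n r h h0 lt; clear -h0 lt.
rewrite mulnA -mulnDl leq_pmul2r //; lia.
Qed.

Lemma card_le_cube_quotient : #|A| <= #|A / H| * #|H|.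
Proof. by rewrite -(card_mul_quotient cGG) // subset_leq_card // mulg_subl. Qed.

Lemma card_cube_group : #|G| = (#|G / H| * #|H|)%N.
Proof. by rewrite -(card_mul_quotient cGG) // mulGSid. Qed.

(** Modulo [H] the cube is proper and aperiodic, so in the critical case [exponent2_cube_critical]
    puts [A] inside [H]. As [A] generates, [H = G], and the nonempty cube would be all of [G]. *)
Lemma cube_quotient_exponent2 :
    1 \in A -> <<A>> = G -> exponent (G / H) = 2 ->
  (3 * #|A / H|)%N != #|G / H| + 1.
Proof.
move=> A1 genA expGH; apply: contraTneq isT => cA.
have nH : G \subset 'N(H) by exact: (abelian_sub_norm cGG (subxx _) sHG).
have nHA : A \subset 'N(H) by apply: subset_trans nH.
have preK B : B \subset G -> coset H @*^-1 (B / H) = B * H.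
  move=> sB; rewrite quotientK ?(subset_trans sB) //.
  by rewrite (mulsgC cGG sHG sB).
have A3H : A * A * A * H = A * A * A by apply: mul_period.
have A3q : A / H * (A / H) * (A / H) = A * A * A / H.
  by rewrite !quotientMr.
have A_H : A / H = 1.
  apply: (@exponent2_cube_critical _ (G / H)) => //.
  - by rewrite expGH.
  - exact: quotientS.
  - by apply/imsetP; exists 1; rewrite ?morph1 // inE A1 group1.
  - apply: contraNneq A3G => eqA3; rewrite -A3H -preK // -A3q eqA3.
    by rewrite preK // mulGSid.
  apply/trivgP/subsetP=> x; rewrite A3q inE => /andP[/morphimP[g Ng Gg ->]].
  move=> /eqP A3g; rewrite inE; apply/eqP/coset_id.
  rewrite inE Gg; apply/eqP.
  have sA3g : A * A * A :* g \subset G by rewrite mul_subG ?sub1set.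
  have sg : [set g] \subset G by rewrite sub1set.
  have : A * A * A :* g * H = A * A * A * H.
    by rewrite -(preK _ sA3g) -(preK _ sA3) quotientMr ?sub1set // quotient_set1 // A3g.
  by rewrite -mulgA (mulsgC cGG sg sHG) mulgA A3H.
have sAH : A \subset H by rewrite -quotient_sub1 // A_H.
have GH : H :=: G by apply/eqP; rewrite eqEsubset sHG -{1}genA gen_subG.
case/eqP: A3G; rewrite -A3H GH.
have A3_1 : 1 \in A * A * A.
  by rewrite -{1}(mulg1 1) mem_mulg // -{1}(mulg1 1) mem_mulg.
apply/eqP; rewrite eqEsubset mul_subG //; apply/subsetP=> x Gx.
by rewrite -(mul1g x) mem_mulg.
Qed.

End Cube.
End UpperBounds.

(** * Large sets with a small threefold product *)

Section Layers.
Import GroupScope.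
Variables (gT : finGroupType).
Implicit Types (K M : {group gT}) (A B : {set gT}) (x : gT).

Lemma abelian_exponent_split K :
  abelian K -> exists x M, [/\ x \in K, #[x] = exponent K, M \subset K,
                               <[x]> :&: M = 1 & <[x]> * M = K].
Proof.
move=> cKK; have [x Kx ox] := exponent_witness (abelian_nil cKK).
have /splitsP[M /complP[tiM defK]] := abelian_splits Kx (esym ox) cKK.
by exists x, M; split=> //; rewrite -defK mulG_subr.
Qed.

Section Split.
Variables (K M : {group gT}) (x : gT).
Hypotheses (cKK : abelian K) (Kx : x \in K) (sMK : M \subset K).
Hypothesis tiM : <[x]> :&: M = 1.

Lemma split_uniq i j l l' :
    i < #[x] -> j < #[x] -> l \in M -> l' \in M ->
  x ^+ i * l = x ^+ j * l' -> i = j /\ l = l'.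
Proof.
move=> ltix ltjx Ml Ml' eq_il.
have eM : (x ^+ j)^-1 * x ^+ i = l' * l^-1.
  by apply: (mulgI (x ^+ j)); rewrite mulKVg mulgA -eq_il mulgK.
have: (x ^+ j)^-1 * x ^+ i \in <[x]> :&: M.
  rewrite inE groupM ?groupV ?mem_cycle //= eM groupM ?groupV //.
rewrite tiM => /set1P eq1; have xij : x ^+ i = x ^+ j.
  by rewrite -(mulKVg (x ^+ j) (x ^+ i)) eq1 mulg1.
split; last by move: eq1; rewrite eM => /(canRL (mulgKV _)); rewrite mul1g.
by apply/eqP; have /eqP := xij; rewrite eq_expg_mod_order !modn_small.
Qed.

(** Keeping exponents below [#[x]] makes the parametrization injective when [<[x]>] meets [M]
    trivially, so the cardinal is that of the index set. *)
Definition layers (k : nat) (B : {set gT}) : {set gT} :=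
  [set x ^+ (p.1 : 'I_#[x]) * p.2 | p in setX [set i : 'I_#[x] | i < k] M
                                         :|: setX [set i : 'I_#[x] | i == k :> nat] B].

Lemma layersP k B y : k < #[x] -> B \subset M ->
  reflect (exists i l, [/\ l \in M, (i < k) || (i == k) && (l \in B) & y = x ^+ i * l])
          (y \in layers k B).
Proof.
move=> ltkx sBM; apply: (iffP imsetP) => [[[i l] /=] | [i [l [Ml il ->]]]].
  rewrite in_setU !in_setX !inE => /orP[/andP[ik Ml] | /andP[ik Bl]] ->; exists i, l.
    by rewrite ik.
  by rewrite (subsetP sBM) // ik Bl orbT.
have ltix : i < #[x] by case/orP: il => [/ltn_trans-> // | /andP[/eqP-> _]].
exists (Ordinal ltix, l) => //; rewrite in_setU !in_setX !inE /= Ml andbT.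
exact: il.
Qed.

Lemma card_layers k B : k < #[x] -> B \subset M ->
  #|layers k B| = (k * #|M| + #|B|)%N.
Proof.
move=> ltkx sBM; rewrite card_in_imset; last first.
  move=> [i l] [j l']; rewrite !in_setU !in_setX /= => ilM jlM eq_il.
  have [||/ord_inj-> -> //] := split_uniq (ltn_ord i) (ltn_ord j) _ _ eq_il.
    by case/orP: ilM => /andP[_ // /(subsetP sBM)].
  by case/orP: jlM => /andP[_ // /(subsetP sBM)].
rewrite cardsU disjoint_setI0 ?cards0 ?subn0; last first.
  rewrite disjoint_subset; apply/subsetP=> [[i l]]; rewrite !in_setX !inE /=.
  by case/andP=> ltik _; rewrite (ltn_eqF ltik).
rewrite !cardsX; congr (_ * _ + _)%N.
  rewrite -sum1dep_card -(big_ord_widen #[x] (fun=> 1%N) (ltnW ltkx)).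
  by rewrite sum1_card card_ord.
rewrite -[RHS]mul1n; congr (_ * _)%N.
rewrite -(cards1 (Ordinal ltkx)); apply: eq_card => i.
by rewrite !inE.
Qed.

Lemma layers_sub k B : k < #[x] -> B \subset M -> layers k B \subset K.
Proof.
move=> ltkx sBM; apply/subsetP=> y /(layersP _ ltkx sBM)[i [l [Ml _ ->]]].
by rewrite groupM ?groupX // (subsetP sMK).
Qed.

(** Exponents in a threefold product are at most [3 * k < #[x]], so nothing wraps around. Exponent
    [#[x] - 1] needs [3 * k + 1 = #[x]] and all factors in the top layer, and then the [M]-part lies
    in [B * B * B]; so part of that coset is missed. *)
Lemma layers_cube k B :
    (3 * k + 1 <= #[x])%N -> B \subset M -> ((3 * k + 1)%N = #[x] -> B * B * B != M) ->
  layers k B * layers k B * layers k B != K.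
Proof.
move=> le3k sBM B3; have ltkx : k < #[x] by clear -le3k; lia.
(* If exponent [#[x] - 1] is out of reach, any [l0] will do, and 1 is taken. *)
have [l0 Ml0 B3l0] : exists2 l0, l0 \in M & (3 * k + 1 = #[x])%N -> l0 \notin B * B * B.
  have [e3k | n3k] := eqVneq (3 * k + 1)%N #[x].
    have: ~~ (M \subset B * B * B).
      by have := B3 e3k; rewrite eqEsubset !mul_subG.
    by case/subsetPn=> l0 Ml0 nB; exists l0.
  by exists 1 => // e; rewrite e eqxx in n3k.
apply: contraTneq isT => L3K.
have: x ^+ #[x].-1 * l0 \in K by rewrite groupM ?groupX // (subsetP sMK).
rewrite -{1}L3K => /mulsgP[_ y3 /mulsgP[y1 y2 Ly1 Ly2 ->] Ly3].
have [i1 [l1 [Ml1 il1 ->]]] := elimT (layersP _ ltkx sBM) Ly1.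
have [i2 [l2 [Ml2 il2 ->]]] := elimT (layersP _ ltkx sBM) Ly2.
have [i3 [l3 [Ml3 il3 ->]]] := elimT (layersP _ ltkx sBM) Ly3.
have [[Kl1 Kl2] Kl3] : (l1 \in K /\ l2 \in K) /\ l3 \in K by rewrite !(subsetP sMK).
have -> : x ^+ i1 * l1 * (x ^+ i2 * l2) * (x ^+ i3 * l3) =
          x ^+ (i1 + i2 + i3)%N * (l1 * l2 * l3).
  have C l l' i j : l \in K -> x ^+ i * l * (x ^+ j * l') = x ^+ (i + j) * (l * l').
    move=> Kl; rewrite expgD -!mulgA (mulgA l).
    by rewrite (abelian_mulC cKK Kl (groupX j Kx)) -mulgA.
  by rewrite !C // groupM.
have le_k i b : (i < k) || (i == k) && b -> i <= k.
  by case/orP=> [/ltnW | /andP[/eqP->]].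
have [[i1k i2k] i3k] := (le_k _ _ il1, le_k _ _ il2, le_k _ _ il3).
have x0 := order_gt0 x.
case/split_uniq; rewrite ?groupM //.
- by rewrite prednK.
- by clear -i1k i2k i3k le3k; lia.
move=> ei el; rewrite el in B3l0.
have [e1 [e2 [e3 e4]]] : i1 = k /\ i2 = k /\ i3 = k /\ (3 * k + 1)%N = #[x].
  by clear -i1k i2k i3k le3k ei x0; lia.
case/negP: (B3l0 e4).
by move: il1 il2 il3; rewrite e1 e2 e3 !ltnn eqxx /= => *; rewrite !mem_mulg.
Qed.

End Split.

(** Induction on the order, by the residue of [#[x]] modulo 3. Only residue 1 leaves a partial
    layer, filled by a large set for the smaller group [M]; the trivial group takes the empty
    set. *)
Lemma exists_large_cube K :
  abelian K -> exists A, [/\ A \subset K, A * A * A != K & #|K| <= 3 * #|A| + 1].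
Proof.
have [n] := ubnP #|K|; elim: n K => // n IHn K leKn cKK.
have [K1 | ntK] := eqVneq (K : {set gT}) 1.
  exists set0; rewrite sub0set {2}K1 cards1 cards0; split=> //.
  by apply: contraTneq (group1 K) => <-; apply/mulsgP=> [[? ? _]]; rewrite inE.
have [x [M [Kx ox sMK tiM defK]]] := abelian_exponent_split cKK.
have cK : #|K| = (#[x] * #|M|)%N by rewrite -defK TI_cardMg.
have x1 : 1 < #[x].
  rewrite ltn_neqAle order_gt0 andbT eq_sym; apply: contraNneq ntK => e.
  by rewrite trivg_exponent -ox e.
have M0 := cardG_gt0 M.
have := divn_eq #[x] 3; have := ltn_pmod #[x] (isT : 0 < 3).
set k := (_ %/ _)%N; case r: (_ %% _)%N => [|[|[|]]] // _ ex.
- have k1 : k.-1 < #[x] by clear -ex x1; lia.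
  exists (layers M x k.-1 M); split; first exact: layers_sub.
    by apply: (layers_cube cKK Kx sMK tiM) => //; clear -ex x1; lia.
  rewrite (card_layers tiM) // cK ex -mulSnr prednK; last by clear -ex x1; lia.
  by clear; nia.
- have ltMn : #|M| < n.
    by rewrite (leq_trans _ (ltnSE leKn)) // cK -[X in X < _]mul1n ltn_pmul2r.
  have [B [sB B3 leB]] := IHn M ltMn (abelianS sMK cKK).
  have k1 : k < #[x] by clear -ex x1; lia.
  exists (layers M x k B); split; first exact: layers_sub.
    by apply: (layers_cube cKK Kx sMK tiM) => //; clear -ex x1; lia.
  by rewrite (card_layers tiM) // cK ex; clear -ex x1 leB; nia.
have k1 : k < #[x] by clear -ex x1; lia.
exists (layers M x k M); split; first exact: layers_sub.
  by apply: (layers_cube cKK Kx sMK tiM) => //; clear -ex x1; lia.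
by rewrite (card_layers tiM) // cK ex; move: #|M|; clear; nia.
Qed.

(** As [#[x]] is not 1, 2 or a multiple of 3, the layer [M] is full, and one element of [x *: M]
    then suffices to generate. The only obstruction is [#[x] = 4] with [B] empty, which forces
    [#|M| = 1], the excluded order 4. *)
Lemma exists_large_generating_cube K :
    abelian K -> exponent K != 2 -> ~~ (3 %| #|K|) -> #|K| != 1%N -> #|K| != 4 ->
  exists A, [/\ A \subset K, 1 \in A, <<A>> = K, A * A * A != K & #|K| <= 3 * #|A| + 1].
Proof.
move=> cKK exp2 K3 K1 K4.
have [x [M [Kx ox sMK tiM defK]]] := abelian_exponent_split cKK.
have cK : #|K| = (#[x] * #|M|)%N by rewrite -defK TI_cardMg.
have x1 : #[x] != 1%N.
  by apply: contraNneq K1 => e; rewrite -trivg_card1 trivg_exponent -ox e.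
have x2 : #[x] != 2 by rewrite ox.
have x3 : ~~ (3 %| #[x]) by apply: contraNN K3 => x3; rewrite cK dvdn_mulr.
have M0 := cardG_gt0 M; have x0 := order_gt0 x.
have gen k B : k < #[x] -> B \subset M -> 0 < k -> (k == 1%N) ==> (B != set0) ->
    1 \in layers M x k B /\ <<layers M x k B>> = K.
  move=> ltkx sB k0 kB.
  have sML : M \subset layers M x k B.
    by apply/subsetP=> l Ml; apply/layersP => //; exists 0%N, l; rewrite k0 mul1g.
  split; first by rewrite (subsetP sML).
  apply/eqP; rewrite eqEsubset gen_subG layers_sub //= -{1}defK mul_subG //; last first.
    exact: subset_trans sML (subset_gen _).
  rewrite cycle_subG; have [B0 | /set0Pn[l Bl]] := eqVneq B set0.
    rewrite mem_gen //; apply/layersP => //; exists 1%N, 1; rewrite mulg1.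
    by rewrite group1 ltn_neqAle eq_sym k0 andbT; move: kB; rewrite B0 eqxx implybF => ->.
  have Ml : l \in M by apply: (subsetP sB).
  have Ll : l \in <<layers M x k B>> by rewrite mem_gen // (subsetP sML).
  rewrite -(groupMr x Ll) mem_gen //; apply/layersP => //; exists 1%N, l; split=> //.
  by rewrite Bl andbT orbC -leq_eqVlt.
have := divn_eq #[x] 3; move: x3; rewrite /dvdn.
have := ltn_pmod #[x] (isT : 0 < 3).
set k := (_ %/ _)%N; case r: (_ %% _)%N => [|[|[|]]] // _ _ ex.
- have [B [sB B3 leB]] := exists_large_cube (abelianS sMK cKK).
  have k1 : k < #[x] by clear -ex x1; lia.
  have k0 : 0 < k by clear -ex x1; lia.
  have kB : (k == 1%N) ==> (B != set0).
    apply/implyP=> /eqP e; apply: contraNneq K4 => B0.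
    by move: leB; rewrite cK ex e B0 cards0 leq_eqVlt ltnNge M0 orbF => /eqP->.
  have [L1 genL] := gen k B k1 sB k0 kB.
  exists (layers M x k B); split=> //; first exact: layers_sub.
    by apply: (layers_cube cKK Kx sMK tiM) => //; clear -ex x1; lia.
  by rewrite (card_layers tiM) // cK ex; clear -ex x1 leB; nia.
have k1 : k < #[x] by clear -ex x1; lia.
have k0 : 0 < k by clear -ex x2; lia.
have kM : (k == 1%N) ==> (M :!=: set0).
  by apply/implyP=> _; apply/set0Pn; exists 1; apply: group1.
have [L1 genL] := gen k M k1 (subxx M) k0 kM.
exists (layers M x k M); split=> //; first exact: layers_sub.
  by apply: (layers_cube cKK Kx sMK tiM) => //; clear -ex x1; lia.
by rewrite (card_layers tiM) // cK ex; move: #|M|; clear; nia.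
Qed.

End Layers.

(** * Maximal sets *)

Section Maximal.
Import GroupScope.
Variables (gT : finGroupType) (G : {group gT}).
Hypothesis cGG : abelian G.
Implicit Types A B : {set gT}.

Lemma cube_diam_ge4 A : A \subset G -> 1 \in A -> diam_ge G A 4 = (A * A * A != G).
Proof. by move=> sA A1; rewrite diam_ge4E // sumpow3. Qed.

(* [A * A] is the complement of [g A^-1], hence [g] is the only element outside
   [A * A * A], and adding any [y] to [A] makes [g = (g y^-1) y] attainable. *)
Lemma complement_rho_maximal A g :
    A \subset G -> 1 \in A -> g \in G -> g \notin A * A * A -> aperiodic G A ->
    (forall z, z \in G -> g * z^-1 \notin A -> z \in A * A) ->
  rho_maximal G 4 A.
Proof.
move=> sA A1 Gg A3g /eqP perA cover; apply/maxsetP; split.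
  by rewrite sA cube_diam_ge4 //; apply: contraNneq A3g => ->.
move=> B /andP[sB dB] sAB; have B1 := subsetP sAB _ A1.
apply/eqP; rewrite eqEsubset sAB andbT; apply/subsetP=> y By.
apply: contraTT dB => A'y; rewrite cube_diam_ge4 // negbK.
have Gy := subsetP sB _ By.
rewrite eqEsubset !mul_subG //=; apply/subsetP=> w Gw.
have [-> | w_g] := eqVneq w g.
  rewrite -(mulgKV y g) mem_mulg // (subsetP (mulgSS sAB sAB)) // cover ?groupM ?groupV //.
  by rewrite invMg invgK mulgA (abelian_mulC cGG Gg Gy) mulgK.
(* If no such [a] exists, multiplication by [g * w^-1] preserves [A], so it is a period and
   [w = g]. *)
have [/exists_inP[a Aa A'a] | noa] := boolP [exists a in A, g * (w * a^-1)^-1 \notin A].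
  rewrite -(mulgKV a w) mem_mulg ?(subsetP sAB) // (subsetP (mulgSS sAB sAB)) //.
  by rewrite cover ?groupM ?groupV // (subsetP sA).
case/eqP: w_g; have: g * w^-1 \in period G A.
  rewrite inE groupM ?groupV //= eqEcard card_rcoset leqnn andbT.
  apply/subsetP=> z; rewrite mem_rcoset => Aa; set a := z * _ in Aa.
  have -> : z = g * (w * a^-1)^-1.
    have Ga := subsetP sA _ Aa.
    by rewrite invMg invgK mulgA (abelian_mulC cGG Gg Ga) -mulgA mulgKV.
  by apply: contraNT noa => A'a; apply/exists_inP; exists a.
by rewrite perA => /set1P/(canRL (mulgKV _)); rewrite mul1g.
Qed.

(** * An extremal set attached to a subgroup of index 3 *)

Section IndexThree.
Variables (L : {group gT}) (x u : gT).
Hypotheses (sLG : L \subset G) (Gx : x \in G).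
Hypotheses (x_dvd : forall i, x ^+ i \in L -> 3 %| i).
Hypothesis decG : forall z, z \in G -> exists i l, [/\ i < 3, l \in L & z = x ^+ i * l].
Hypotheses (Lu : u \in L) (u_neq1 : u != 1) (L_gt2 : 2 < #|L|).

Let A := x |: (L :\ u).

Let x_uniq i j l l' : l \in L -> l' \in L -> x ^+ i * l = x ^+ j * l' -> i = j %[mod 3].
Proof.
wlog leij : i j l l' / i <= j.
  move=> IH Ll Ll' e; case: (leqP i j) => [|/ltnW] leij; first exact: (IH i j l l').
  by apply/esym; apply: (IH j i l' l).
move=> Ll Ll' e; apply/eqP; rewrite eq_sym eqn_mod_dvd //; apply: x_dvd.
rewrite -(mulgK l' (x ^+ (j - i))) groupM ?groupV //.
suff -> : x ^+ (j - i) * l' = l by [].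
by apply: (mulgI (x ^+ i)); rewrite mulgA -expgD subnKC.
Qed.

Let AP y : y \in A -> exists i l, [/\ l \in L, y = x ^+ i * l &
  (i = 0%N /\ l != u) \/ (i = 1%N /\ l = 1)].
Proof.
case/setU1P=> [-> | /setD1P[nu Ll]].
  by exists 1%N, 1; rewrite group1 mulg1; split=> //; right.
by exists 0%N, y; rewrite mul1g; split=> //; left.
Qed.

Let x_notin_L : x \notin L.
Proof. by apply/negP=> Lx; have := @x_dvd 1 Lx. Qed.

Let sAG : A \subset G.
Proof. by rewrite subUset sub1set Gx (subset_trans (subsetDl _ _)). Qed.

Let A1 : 1 \in A.
Proof. by rewrite !inE group1 (eq_sym 1 u) u_neq1 orbT. Qed.

Let C l i : l \in L -> l * x ^+ i = x ^+ i * l.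
Proof. by move=> Ll; rewrite (abelian_mulC cGG) ?groupX // (subsetP sLG). Qed.

Let LA2 l : l \in L -> l \in A * A.
Proof.
(* Avoiding these values keeps both [a] and [a^-1 * l] different from [u]. *)
move=> Ll; have [a La] : exists2 a, a \in L & a \notin [set u; l * u^-1].
  apply/subsetPn; apply/negP=> /subset_leq_card; rewrite leqNgt => /negP[].
  by apply: leq_ltn_trans L_gt2; rewrite cards2; case: (u == _).
rewrite !inE negb_or => /andP[a_u a_lu].
rewrite -(mulKVg a l) mem_mulg // !inE ?a_u ?La ?orbT // groupM ?groupV // andbT.
rewrite orbC; apply/orP; left; apply: contraNneq a_lu => <-.
by rewrite invMg invgK mulKVg.
Qed.

(** The missing element is [x ^+ 2 * u]: a threefold product in the coset of [x ^+ 2] has two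
    factors [x] and a third one in [L :\ u]. *)
Lemma index3_rho_maximal :
  [/\ rho_maximal G 4 A, <<A>> = G, aperiodic G A & #|A| = #|L|].
Proof.
(* A period [h] sends 1 and [x] into the union of [L] and [x *: L], so [h] is in [L]. Then [x * h]
   is the only element of [A] in [x *: L], namely [x]. *)
have perA : aperiodic G A.
  apply/eqP/trivgP/subsetP=> h; rewrite inE => /andP[Gh /eqP Ah].
  have [i [l [lti3 Ll eh]]] := decG Gh.
  have AAh a : a \in A -> a * h \in A by rewrite -{2}Ah mem_rcoset mulgK.
  have := AAh _ A1; rewrite mul1g => /AP[j [l' [Ll' eh' jl']]].
  have := AAh _ (setU11 _ _) => /AP[k [l'' [Ll'' exh kl'']]].
  have: i = j %[mod 3] by apply: (@x_uniq _ _ l l'); rewrite // -eh.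
  have: i.+1 = k %[mod 3] by apply: (@x_uniq _ _ l l''); rewrite // -exh eh expgS mulgA.
  case: jl' kl'' => [[j0 _] | [j1 _]] [[k0 _] | [k1 l1]]; rewrite ?j0 ?j1 ?k0 ?k1.
  - by case: (i) lti3 => [|[|[|]]].
  - by move: exh; rewrite k1 l1 mulg1 -{2}(mulg1 x) => /mulgI->; rewrite inE.
  - by case: (i) lti3 => [|[|[|]]].
  - by case: (i) lti3 => [|[|[|]]].
(* [LA2] covers [L]. In the coset of [x] only [x * u] could fail, but it violates the hypothesis; in
   that of [x ^+ 2] the hypothesis leaves only [x * x]. *)
have cover z : z \in G -> x ^+ 2 * u * z^-1 \notin A -> z \in A * A.
  case/decG=> i [l [lti3 Ll ->]]; case: i lti3 => [|[|[|i]]] // _.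
  - by rewrite mul1g LA2.
  - rewrite expg1 => nA; rewrite mem_mulg ?setU11 // !inE Ll andbT orbC.
    apply/orP; left; apply: contraNneq nA => ->.
    by rewrite invMg mulgA mulgK expgS expg1 mulgK setU11.
  have <- : u * l^-1 = x ^+ 2 * u * (x ^+ 2 * l)^-1.
    by rewrite invMg mulgA -(mulgA (x ^+ 2)) -(@C (u * l^-1)) ?mulgK ?groupM ?groupV.
  rewrite !inE negb_or.
  case/andP=> _; rewrite groupM ?groupV // andbT negbK => /eqP.
  rewrite -{2}(mulg1 u) => /mulgI/eqP; rewrite invg_eq1 => /eqP->.
  by rewrite mulg1 expgS expg1 mem_mulg ?setU11.
split=> //.
- apply: (@complement_rho_maximal _ (x ^+ 2 * u)) => //.
    by rewrite groupM ?groupX // (subsetP sLG).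
  apply/mulsgP=> [[_ y3 /mulsgP[y1 y2 Ay1 Ay2 ->] Ay3]].
  have [i1 [l1 [Ll1 -> il1]]] := AP Ay1.
  have [i2 [l2 [Ll2 -> il2]]] := AP Ay2.
  have [i3 [l3 [Ll3 -> il3]]] := AP Ay3.
  have sw i j l l' : l \in L -> x ^+ i * l * (x ^+ j * l') = x ^+ (i + j) * (l * l').
    by move=> Ll; rewrite expgD -!mulgA (mulgA l) C // -mulgA.
  rewrite !sw ?groupM // => e; have := @x_uniq _ _ _ _ Lu (groupM (groupM Ll1 Ll2) Ll3) e.
  case: il1 il2 il3 e => [[-> nu1] | [-> ->]] [[-> nu2] | [-> ->]]
    [[-> nu3] | [-> ->]] //= /mulgI.
  + by rewrite !mulg1 => e; rewrite e eqxx in nu1.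
  + by rewrite mul1g mulg1 => e; rewrite e eqxx in nu2.
  + by rewrite !mul1g => e; rewrite e eqxx in nu3.
- apply/eqP; rewrite eqEsubset gen_subG sAG; apply/subsetP=> z Gz.
  have [i [l [_ Ll ->]]] := decG Gz.
  rewrite groupM //; first by rewrite groupX // mem_gen // setU11.
  by have := LA2 Ll => /mulsgP[a b Aa Ab ->]; rewrite groupM // mem_gen.
rewrite cardsU1 !inE (negPf x_notin_L) andbF.
by rewrite (cardsD1 u L) Lu.
Qed.

End IndexThree.

(** A subgroup of index 3 has order 2, too small for [index3_rho_maximal]; 1 and a generator are
    taken instead. *)
Lemma order6_rho_maximal : #|G| = 6 ->
  exists A, [/\ rho_maximal G 4 A, <<A>> = G, aperiodic G A & #|A| = 2].
Proof.
move=> G6; have [x [M [Gx ox _ _ _]]] := abelian_exponent_split cGG.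
have ox6 : #[x] = 6.
  have dvd_x p : prime p -> p %| #|G| -> p %| #[x].
    move=> pr_p pG; have: p \in \pi(G) by rewrite mem_primes pr_p cardG_gt0.
    by rewrite -pi_of_exponent -ox mem_primes => /and3P[].
  apply/eqP; rewrite eqn_dvd -{1}G6 order_dvdG //= (@Gauss_dvd 2 3) //.
  by rewrite !dvd_x ?G6.
have x_neq1 : x != 1 by rewrite -order_eq1 ox6.
pose A := [set 1; x].
have sA : A \subset G by rewrite subUset !sub1set group1.
have A1 : 1 \in A by rewrite !inE eqxx.
have genA : <<A>> = G.
  apply/eqP; rewrite eqEcard gen_subG sA G6 -ox6 orderE subset_leq_card //.
  by rewrite genS // sub1set !inE eqxx orbT.
have cA : #|A| = 2 by rewrite cards2 eq_sym x_neq1.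
have AP y : y \in A -> exists b : bool, y = x ^+ b.
  by rewrite !inE => /orP[] /eqP->; [exists false | exists true].
have A3 : A * A * A != G.
  apply: contraTneq (groupX 5 Gx) => <-.
  apply/mulsgP=> [[y y3 /mulsgP[y1 y2 /AP[b1 ->] /AP[b2 ->] ->] /AP[b3 ->]]] /eqP.
  by rewrite -!expgD eq_expg_mod_order ox6; case: b1; case: b2; case: b3.
exists A; split=> //; last first.
  apply/eqP/trivgP/subsetP=> h; rewrite inE => /andP[_ /eqP Ah].
  have AAh a : a \in A -> a * h \in A by rewrite -{2}Ah mem_rcoset mulgK.
  have := AAh _ A1; rewrite mul1g => /AP[b eh].
  have : x * h \in A by rewrite AAh // !inE eqxx orbT.
  case/AP=> b'; rewrite eh -expgS => /eqP; rewrite eq_expg_mod_order ox6.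
  by case: b {eh}; [case: b' | rewrite inE].
apply/maxsetP; rewrite sA cube_diam_ge4 //; split=> // B /andP[sB] dB sAB.
have B1 := subsetP sAB _ A1; move: dB; rewrite cube_diam_ge4 // => B3.
have genB : <<B>> = G by apply/eqP; rewrite eqEsubset gen_subG sB -genA genS.
apply/esym/eqP; rewrite eqEcard sAB cA.
have := cube_quotient_bound cGG sB B3; have := card_le_cube_quotient cGG sB.
have := card_cube_group cGG B; rewrite G6; set H := period_group G _ => e6.
(* As 1 is in [B], an image of one element puts the generating set [B] inside [H]. *)
have q1 : #|B / H| = 1%N -> #|G / H| = 1%N.
  move/eqP/cards1P=> [b Bb].
  have sBH : B \subset H.
    rewrite -quotient_sub1 ?(abelian_sub_norm cGG) ?period_sub // Bb sub1set.
    have : coset H 1 \in B / H by rewrite mem_morphim ?group1.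
    by rewrite Bb morph1 => /set1P<-; rewrite inE.
  have -> : H = G; last by rewrite trivg_quotient cards1.
  by apply/group_inj/eqP; rewrite eqEsubset period_sub -{1}genB gen_subG.
move: e6 q1; rewrite -/H; move: #|B / H| #|G / H| #|H| #|B|.
move=> q n h b; clear; case: q => [|[|q]]; case: n => [|[|[|[|[|[|[|n]]]]]]]; nia.
Qed.

(** Since 3 divides the exponent [#[x]], the subgroup [<[x ^+ 3]> * M] has index 3; apart from order
    6 it has more than two elements. *)
Lemma exists_third_rho_maximal : 3 %| #|G| -> 4 < #|G| ->
  exists A, [/\ rho_maximal G 4 A, <<A>> = G, aperiodic G A & (3 * #|A|)%N = #|G|].
Proof.
move=> G3 G_gt4; have [G6 | G_neq6] := eqVneq #|G| 6.
  by have [A [? ? ? cA]] := order6_rho_maximal G6; exists A; rewrite cA G6.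
have [x [M [Gx ox sMG tiM defG]]] := abelian_exponent_split cGG.
have x3 : 3 %| #[x].
  have: 3 \in \pi(G) by rewrite mem_primes cardG_gt0 G3.
  by rewrite -pi_of_exponent -ox mem_primes => /and3P[].
have cG : #|G| = (#[x] * #|M|)%N by rewrite -defG TI_cardMg.
have sx3 : <[x ^+ 3]> \subset G by rewrite cycle_subG groupX.
have gL : group_set (<[x ^+ 3]> * M) by apply/comm_group_setP/(mulsgC cGG).
pose L := group gL.
have cL : #|L| = (#[x] %/ 3 * #|M|)%N.
  rewrite /= TI_cardMg; first by rewrite -orderE orderXdiv.
  apply/trivgP; rewrite -tiM setSI // cycle_subG mem_cycle //.
have cLG : (3 * #|L|)%N = #|G| by rewrite cL cG mulnA (mulnC 3) divnK.
have L_gt2 : 2 < #|L|.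
  by move: cLG G_gt4 G_neq6; move: #|L| #|G| => [|[|[|l]]] g; clear; lia.
have [u Lu u1] : exists2 u, u \in L & u != 1.
  by apply/trivgPn; apply: contraTneq L_gt2 => ->; rewrite cards1.
have [] := @index3_rho_maximal L x u.
- by rewrite /= mul_subG.
- by [].
- move=> i /mulsgP[_ m /cycleP[j ->] Mm e].
  have: (x ^+ 3 ^+ j)^-1 * x ^+ i \in <[x]> :&: M.
    by rewrite inE groupM ?groupV ?groupX ?cycle_id //= e mulKg.
  rewrite tiM => /set1P/(canRL (mulKVg _)); rewrite mulg1 -expgM => /eqP.
  rewrite eq_expg_mod_order => /eqP/(congr1 (modn^~ 3)).
  by rewrite /= !modn_dvdm // mulnC modnMl /dvdn => ->.
- rewrite -defG => _ /mulsgP[_ m /cycleP[j ->] Mm ->].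
  exists (j %% 3)%N, (x ^+ 3 ^+ (j %/ 3) * m); rewrite ltn_pmod //; split=> //.
    by apply: mem_mulg; rewrite ?mem_cycle.
  by rewrite mulgA -expgM -expgD addnC mulnC -divn_eq.
- by [].
- by [].
- by [].
by move=> ? ? ? cA; exists (x |: (L :\ u)); rewrite cA.
Qed.

End Maximal.

(** * The extremal cardinals *)

Section Extremal.
Import GroupScope.
Variables (gT : finGroupType) (G : {group gT}).
Hypothesis cGG : abelian G.
Implicit Types (A : {set gT}) (H : {group gT}).

(** With [H] the period of the cube, [A * H] has the same cube as [A]. Maximality gives [A * H = A],
    and aperiodicity makes [H] trivial. *)
Lemma aperiodic_rho_maximal_card A :
  rho_maximal G 4 A -> aperiodic G A -> 3 * #|A| <= #|G| + 1.
Proof.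
case/maxsetP=> /andP[sA dA] maxA /eqP perA.
have A1 : 1 \in A.
  rewrite -(maxA (1 |: A)) ?setU11 ?subsetUr // subUset sub1G sA /=.
  by move: dA; rewrite !diam_ge4E // ?subUset ?sub1G // !sumpowE setUA setUid.
move: dA; rewrite cube_diam_ge4 // => A3.
pose H := period_group G (A * A * A); have sH : H \subset G by apply: period_sub.
have sAH : A * H \subset G by rewrite mul_subG.
have A3H : A * A * A * H = A * A * A by apply: mul_period.
have AH : A * H = A.
  apply: maxA; last by rewrite mulg_subl.
  have AH1 : 1 \in A * H by rewrite -(mulg1 1) mem_mulg.
  rewrite sAH cube_diam_ge4 // (_ : A * H * _ * _ = A * A * A) //.
  by rewrite !(mulsG_mulsG cGG) // A3H.
have H1 : #|H| = 1%N.
  apply/eqP; rewrite -trivg_card1; apply/eqP/trivgP.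
  by rewrite -perA; apply: sub_period.
have := cube_quotient_bound cGG sA A3; have := card_le_cube_quotient cGG sA.
have := card_cube_group cGG A; rewrite -/H H1 !muln1 => -> leA leq.
by apply: leq_trans leq; rewrite leq_mul2l.
Qed.

(** As [#|G / H|] is 1 modulo 3, the quotient bound improves to [3 * #|A / H| + 1 <= #|G / H|]. *)
Lemma cube_card_divisors_mod3 A :
    (forall d, d %| #|G| -> (d %% 3)%N = 1%N) -> A \subset G -> A * A * A != G ->
  3 * #|A| + 1 <= #|G|.
Proof.
move=> G_1 sA A3.
have := cube_quotient_bound cGG sA A3; have := card_le_cube_quotient cGG sA.
have := card_cube_group cGG A; set H := period_group G _ => e leA.
have : (#|G / H| %% 3)%N = 1%N by rewrite G_1 // e dvdn_mulr.
have := cardG_gt0 H; move: e leA.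
move: #|G / H| #|A / H| #|H| #|A| #|G|; clear => n q h a g -> lea h0 n1 leq.
have leq' : 3 * q + 1 <= n by lia.
apply: (@leq_trans ((3 * q + 1) * h)%N); last by rewrite leq_mul2r leq' orbT.
by rewrite mulnDl mul1n leq_add // -mulnA leq_mul2l lea orbT.
Qed.

Lemma eta_attained : eta_grp G != 0%N ->
  exists H, [/\ H \subset G, exponent (G / H) != 2, (#|G / H| %% 3)%N = 2
              & eta_grp G = #|H|].
Proof.
rewrite /eta_grp => eta_neq0.
case: (pickP (fun H : {group gT} => [&& H \subset G, exponent (G / H) != 2
                            & #|G / H| %% 3 == 2])) => [H0 PH0 | noH]; last first.
  by rewrite big_pred0 in eta_neq0.
have [|H /and3P[sH expH /eqP mH] ->] := @eq_bigmax_cond _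
  (fun H : {group gT} => [&& H \subset G, exponent (G / H) != 2
                            & #|G / H| %% 3 == 2]) (fun H => #|H|).
  by apply/card_gt0P; exists H0.
by exists H.
Qed.

Lemma card_le_eta H :
    H \subset G -> exponent (G / H) != 2 -> (#|G / H| %% 3)%N = 2 ->
  #|H| <= eta_grp G.
Proof.
move=> sH expH /eqP mH; rewrite /eta_grp.
by apply: (leq_bigmax_cond (F := fun H : {group gT} => #|H|)); rewrite sH expH mH.
Qed.

(** [3 * #|A / H|] exceeds [#|G / H|] only if the latter is 2 modulo 3. Exponent 2 is then excluded
    by [cube_quotient_exponent2], so [H] competes in [eta_grp G]. *)
Lemma generating_cube_card A :
    A \subset G -> 1 \in A -> <<A>> = G -> A * A * A != G ->
  [/\ 3 * #|A| <= #|G| + eta_grp G & 3 * #|A| <= #|G| \/ eta_grp G != 0%N].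
Proof.
move=> sA A1 genA A3.
have := cube_quotient_bound cGG sA A3; have := card_le_cube_quotient cGG sA.
have := cube_quotient_exponent2 cGG sA A3 A1 genA.
have := card_cube_group cGG A; set H := period_group G _.
have sH : H \subset G by apply: period_sub.
have H0 := cardG_gt0 H.
have [exp2 | /(card_le_eta sH)] := eqVneq (exponent (G / H)) 2.
  move=> e /(_ exp2); move: H0 e.
  move: #|G / H| #|A / H| #|H| #|A| #|G| (eta_grp G); clear.
  by move=> n q h a g eta h0 -> neq lea le; split; [|left]; nia.
move: H0; move: #|G / H| #|A / H| #|H| #|A| #|G| (eta_grp G); clear.
move=> n q h a g eta h0 leta -> _ lea le.
have [n2 | n2] := eqVneq (n %% 3)%N 2.
  by have := leta n2; split; [|right]; nia.
have le' : 3 * q <= n by lia.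
by split; [|left]; nia.
Qed.

(** A large generating set of [G / H] is pulled back. Residue 2 excludes orders 1, 4 and multiples
    of 3, and sharpens the bound to [#|G / H| + 1 <= 3 * #|C|]. *)
Lemma lift_generating_cube H :
    H \subset G -> exponent (G / H) != 2 -> (#|G / H| %% 3)%N = 2 ->
  exists A, [/\ A \subset G, 1 \in A, <<A>> = G, A * A * A != G
              & #|G| + #|H| <= 3 * #|A|].
Proof.
move=> sH expH mH; have nsH : H <| G by rewrite -sub_abelian_normal.
have cG : #|G| = (#|G / H| * #|H|)%N.
  by rewrite card_quotient ?normal_norm // mulnC Lagrange.
have [||| C [sC C1 genC C3 leC]] :=
  exists_large_generating_cube (quotient_abelian H cGG) expH.
- by rewrite /dvdn mH.
- by apply: contra_eq_neq mH => ->.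
- by apply: contra_eq_neq mH => ->.
have preG : coset H @*^-1 (G / H) = G by apply: quotientGK.
exists (coset H @*^-1 C); split.
- by rewrite -preG morphpreS.
- by rewrite mem_morphpre ?group1 // morph1.
- by rewrite -cosetpre_gen // genC.
- rewrite -!morphpreMl ?sub_im_coset // -preG.
  by apply: contra_neq C3 => /(congr1 (fun B => B / H)); rewrite !cosetpreK.
rewrite card_cosetpre_set cG; move: mH leC.
move: #|G / H| #|C| #|H|; clear => n c h mH leC.
by rewrite -mulSnr mulnA leq_mul2r; apply/orP; right; lia.
Qed.

End Extremal.

Theorem theorem2p7 (gT : finGroupType) (G : {group gT}) :
  abelian G -> diam_plus_ge G 4 ->
  ((3 %| #|G| -> 3 * t_rho G 4 = #|G|) /\
   ((forall d, d %| #|G| -> d %% 3 = 1) -> 3 * t_rho G 4 = #|G| - 1)) /\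
  (exponent G != 2 ->
     3 * s_rho G 4 =
       (if eta_grp G != 0 then #|G| + eta_grp G
        else if 3 %| #|G| then #|G| else #|G| - 1)).
Proof.
move=> cGG /diam_plus_ge4_card G_gt4.
have t_ge (A : {set gT}) : rho_maximal G 4 A -> <<A>>%g = G -> aperiodic G A ->
    #|A| <= t_rho G 4.
  move=> maxA genA perA; apply: (leq_bigmax_cond (F := fun A : {set gT} => #|A|)).
  by rewrite maxA genA eqxx.
have s_ge (A : {set gT}) : A \subset G -> (1 \in A)%g -> <<A>>%g = G ->
    (A * A * A)%g != G -> #|A| <= s_rho G 4.
  move=> sA A1 genA A3; apply: (leq_bigmax_cond (F := fun A : {set gT} => #|A|)).
  by rewrite sA cube_diam_ge4 // A3 diam_finiteE // genA eqxx.
have t_le : 3 * t_rho G 4 <= #|G| + 1.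
  rewrite mulnC -leq_divRL //; apply/bigmax_leqP=> A /and3P[maxA _ perA].
  by rewrite leq_divRL // mulnC aperiodic_rho_maximal_card.
have third : 3 %| #|G| -> 3 * t_rho G 4 = #|G|.
  move=> G3; have [A [maxA genA perA cA]] := exists_third_rho_maximal cGG G3 G_gt4.
  have := t_ge A maxA genA perA; move: G3 t_le cA; move: #|G| #|A| (t_rho G 4).
  by clear; lia.
split; first split=> // G_1.
  have G_mod : #|G| %% 3 = 1 by apply: G_1.
  have [|||| A [sA A1 genA A3 leA]] := exists_large_generating_cube cGG.
  - by apply/eqP=> exp2; have /G_1 : 2 %| #|G| by rewrite -exp2 exponent_dvdn.
  - by rewrite /dvdn G_mod.
  - by case: #|G| G_gt4 => [|[]].
  - by case: #|G| G_gt4 => [|[|[|[|[]]]]].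
  have leB B := @cube_card_divisors_mod3 _ _ cGG B G_1.
  have cA : 3 * #|A| + 1 = #|G| by apply/eqP; rewrite eqn_leq leA leB.
  (* [A] has the largest cardinal possible for a proper cube, hence is maximal under inclusion. *)
  have maxA : rho_maximal G 4 A.
    apply/maxsetP; rewrite sA cube_diam_ge4 //; split=> // B /andP[sB dB] sAB.
    apply/esym/eqP; rewrite eqEcard sAB /=.
    have := leB B sB; rewrite -cube_diam_ge4 // ?(subsetP sAB) // => /(_ dB).
    by rewrite -cA leq_add2r leq_mul2l.
  (* The order of the period divides both [#|A|] and [3 * #|A| + 1]. *)
  have perA : aperiodic G A.
    rewrite /aperiodic -[period G A]/(gval (period_group G A)) trivg_card1 -dvdn1.
    rewrite -(dvdn_addr (m := 3 * #|A|)) ?cA ?cardSg ?period_sub //.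
    by rewrite dvdn_mull // (dvdn_card_periodic cGG) ?period_sub ?mul_period.
  have := t_ge A maxA genA perA; move: G_mod t_le cA; move: #|G| #|A| (t_rho G 4).
  by clear; lia.
move=> expG.
(* Adjoining 1 changes neither the sets [sumpow] nor the generated subgroup. *)
have s_le N : (forall A : {set gT}, A \subset G -> (1 \in A)%g -> <<A>>%g = G ->
    (A * A * A)%g != G -> 3 * #|A| <= N) -> 3 * s_rho G 4 <= N.
  move=> leN; rewrite mulnC -leq_divRL //; apply/bigmax_leqP=> A /and3P[sA dA genA].
  have sA1 : (1 |: A)%g \subset G by rewrite subUset sub1G.
  apply: leq_trans (subset_leq_card (subsetUr 1%g A)) _.
  rewrite leq_divRL // mulnC leN ?setU11 //.
    rewrite diam_finiteE // in genA.
    by apply/eqP; rewrite eqEsubset gen_subG sA1 -(eqP genA) genS ?subsetUr.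
  rewrite -cube_diam_ge4 ?setU11 // diam_ge4E //.
  by move: dA; rewrite diam_ge4E // !sumpowE setUA setUid.
have gen_le := @generating_cube_card _ _ cGG.
case: ifPn => [eta_neq0 | /negPn/eqP eta0].
  apply/eqP; rewrite eqn_leq s_le => [|A sA A1 genA A3]; last by case: (gen_le A).
  have [H [sH expH mH ->]] := eta_attained eta_neq0.
  have [A [sA A1 genA A3 leA]] := lift_generating_cube cGG sH expH mH.
  by rewrite (leq_trans leA) // leq_mul2l s_ge.
have s_le_card : 3 * s_rho G 4 <= #|G|.
  by apply: s_le => A sA A1 genA A3; case: (gen_le A) => // _ []; rewrite ?eta0.
case: ifPn => G3.
  (* Every set counted by [t_rho] is counted by [s_rho], so part (i) gives the lower bound. *)
  apply/eqP; rewrite eqn_leq s_le_card -third // leq_mul2l /=.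
  apply/bigmax_leqP=> A /and3P[maxA genA perA].
  have [/andP[sA dA] _] := maxsetP maxA.
  apply: (leq_bigmax_cond (F := fun A : {set gT} => #|A|)).
  by rewrite sA dA diam_finiteE.
have G_mod : #|G| %% 3 = 1.
  (* Otherwise the trivial subgroup would make [eta_grp G] nonzero. *)
  have : #|G| %% 3 != 2.
    apply/eqP=> G2; have := @card_le_eta _ G 1%G (sub1G G).
    rewrite eta0 cards1 -(card_isog (quotient1_isog G)).
    by rewrite -(exponent_isog (quotient1_isog G)) => /(_ expG G2).
  by move: G3 (ltn_pmod #|G| (isT : 0 < 3)); rewrite /dvdn; case: (_ %% _) => [|[|[|]]].
have [|| A [sA A1 genA A3 leA]] := exists_large_generating_cube cGG expG G3.
- by case: #|G| G_gt4 => [|[]].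
- by case: #|G| G_gt4 => [|[|[|[|[]]]]].
have := s_ge A sA A1 genA A3; move: G_mod s_le_card leA.
by move: #|G| #|A| (s_rho G 4); clear; lia.
Qed.
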